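(* Let $R$ be a commutative finite chain ring of nilpotency index $e$ and residue field $\mathbb{F}_q$, and let $n$ be a positive divisor of $q-1$. Then \[c_n(R,0)=q^{ne}-(q-1)^n q^{(e-1)n}\sum_{i=0}^{e-1}\binom{n+i-1}{n-1}q^{-i}.\]
   Context: A commutative finite chain ring (CFCR) is a finite commutative ring $R$ with identity $1\neq 0$ whose ideals are linearly ordered by inclusion. Its unique maximal ideal is principal; for a generator $\gamma$ of it, the nilpotency index of $R$ is the smallest positive integer $e$ with $\gamma^e=0$, and the residue field is $R/\gamma R\cong\mathbb{F}_q$ for a prime power $q$. An $n\times n$ circulant matrix over a commutative ring $S$ is a matrix $\mathrm{cir}(a_1,\dots,a_n)$ with first row $(a_1,a_2,\dots,a_n)$, $a_i\in S$, in which each subsequent row is the right cyclic shift of the previous row. For $a\in S$, $c_n(S,a)$ denotes the number of $n\times n$ circulant matrices over $S$ with determinant $a$. *)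

(* Defs.v *)
From HB Require Import structures.
From mathcomp Require Import all_boot all_order all_algebra.

Set Implicit Arguments.
Unset Strict Implicit.
Unset Printing Implicit Defensive.

Import Order.TTheory GRing.Theory Num.Theory.
Local Open Scope ring_scope.

(* Ideals of R are the submodules of the regular module R^o; unlike the
   library's [idealr R], this includes the improper ideal R itself. *)
Definition is_ideal (R : comNzRingType) (I : {pred R}) : Prop :=
  @GRing.submod_closed R R^o I.

Definition chain_ring (R : finComNzRingType) : Prop :=
  forall I J : {pred R}, is_ideal I -> is_ideal J ->
    {subset I <= J} \/ {subset J <= I}.

(* [idealr R] is the library's type of proper ideals, so M != R is built in. *)
Definition maximal_ideal (R : comNzRingType) (M : idealr R) : Prop :=
  forall J : {pred R}, is_ideal J -> {subset M <= J} ->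
    {subset J <= M} \/ (forall x, x \in J).

Definition generates (R : comNzRingType) (g : R) (I : {pred R}) : Prop :=
  forall x, x \in I <-> exists y, x = g * y.

Definition nilpotency_index (R : comNzRingType) (g : R) (e : nat) : Prop :=
  [/\ (0 < e)%N, g ^+ e = 0 &
      forall k : nat, (0 < k)%N -> g ^+ k = 0 -> (e <= k)%N].

(* [ord_pred] is the cyclic predecessor on 'I_n, so row i.+1 of [cir a] is
   row i shifted cyclically one place to the right, and row 0 is [a]. *)
Definition cir (T : Type) (n : nat) (a : 'rV[T]_n) : 'M[T]_n :=
  \matrix_(i, j) a ord0 (iter i (@ord_pred n) j).

Definition circulant (S : finType) (n : nat) (A : 'M[S]_n) : bool :=
  [exists a : 'rV[S]_n, A == cir a].

Definition num_circulant_det (S : finComNzRingType) (n : nat) (a : S) : nat :=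
  #|[set A : 'M[S]_n | circulant A & \det A == a]|.

(* Main.v *)
Require Import Defs.
From HB Require Import structures.
From mathcomp Require Import all_boot all_order all_algebra.
From mathcomp Require Import all_solvable all_field.
From mathcomp Require Import ring zify.

Set Implicit Arguments.
Unset Strict Implicit.
Unset Printing Implicit Defensive.

(** The residue field contains a primitive [n]-th root of unity; raising a lift
    of it to the power [q ^ e] gives [w] in [R] with [w ^+ n = 1] and the same
    residue. The Vandermonde matrix [V] of the powers of [w] is invertible and
    diagonalises every circulant matrix simultaneously, so circulant matrices
    of determinant 0 correspond to [n]-tuples of [R] with product 0. Up to a
    unit each element is a power of [gamma], so such tuples are those whose
    valuations add up to at least [e]. Since [(q - 1) q ^ (e - 1 - k)] elements
    have valuation [k < e], the tuples of total valuation [i < e] are counted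
    by the coefficients of the [n]-th power of a truncated geometric series. *)

Import Order.TTheory GRing.Theory Num.Theory.
Local Open Scope ring_scope.

(** * Roots of unity in the residue field *)

Lemma natr_card_eq0 (F : finFieldType) : #|F|%:R = 0 :> F.
Proof.
(* Translation by 1 permutes the field, so the sum of all elements equals itself plus [#|F|]. *)
have := reindex_inj (op := +%R) (x := 0) (P := xpredT) (F := id) (addIr (1 : F)).
rewrite big_split /= sumr_const => /eqP.
by rewrite -subr_eq0 opprD addNKr oppr_eq0 => /eqP.
Qed.

(** The nonzero elements are [#|F|.-1] distinct roots of unity of that order, so one of them is
    primitive; a power of it has order [n]. *)
Lemma ex_prim_root (F : finFieldType) (n : nat) :
  (0 < n)%N -> (n %| #|F|.-1)%N -> exists z : F, n.-primitive_root z.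
Proof.
move=> n_gt0 dvd_n.
have F_gt1 : (1 < #|F|)%N := finNzRing_gt1 F.
set rs := enum [set x : F | x != 0].
have sz_rs : size rs = #|F|.-1.
  by rewrite -cardE cardsE -(cardC1 (0 : F)); apply: eq_card.
have : has (#|F|.-1).-primitive_root rs.
  apply: has_prim_root; rewrite ?sz_rs ?enum_uniq //; first by lia.
  apply/allP => x; rewrite mem_enum inE => x0.
  rewrite unity_rootE; apply/eqP/(mulfI x0).
  by rewrite -exprS prednK ?expf_card ?mulr1 //; lia.
case/hasP => z _ prim_z.
by exists (z ^+ (#|F|.-1 %/ n)); apply: dvdn_prim_root.
Qed.

(** * Units, powers of the maximal ideal, and valuation *)

Section ChainRing.

Variables (R : finComNzRingType) (F : finFieldType).
Variables (res : {rmorphism R -> F}) (s : F -> R) (g : R) (e : nat).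
Hypothesis sK : cancel s res.
Hypothesis res_ker : forall x, res x = 0 <-> exists y, x = g * y.
Hypothesis ge0 : g ^+ e = 0.
Hypothesis gN0 : forall k, (k < e)%N -> g ^+ k != 0.

Lemma res_g x : res (g * x) = 0.
Proof. by apply/res_ker; exists x. Qed.

(** If [y] lifts the inverse residue, [1 - x * y] is a multiple of [g], hence nilpotent, and a
    finite geometric series inverts [x * y]. *)
Lemma res_neq0_inv x : res x != 0 -> exists y, x * y = 1.
Proof.
move=> rx; pose y := s (res x)^-1.
have /res_ker[t xy] : res (1 - x * y) = 0.
  by rewrite rmorphB rmorphM rmorph1 sK divff // subrr.
exists (y * \sum_(i < e) (1 - x * y) ^+ i).
rewrite mulrA; apply/oppr_inj/esym; have := subrX1 (1 - x * y) e.
by rewrite {1}xy exprMn ge0 mul0r sub0r addrAC subrr sub0r mulNr.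
Qed.

Lemma expg_mul_eq0 k u : res u != 0 -> (g ^+ k * u == 0) = (e <= k)%N.
Proof.
case/res_neq0_inv => w uw; have [le_ek|lt_ke] := leqP e k.
  by rewrite -(subnK le_ek) exprD ge0 mulr0 mul0r eqxx.
apply: contraNF (gN0 lt_ke) => /eqP gu0.
by rewrite -[_ ^+ k]mulr1 -uw mulrA gu0 mul0r.
Qed.

Lemma res_expg_mul0 k x : (k < e)%N -> g ^+ k * x = 0 -> res x = 0.
Proof.
move=> lt_ke /eqP gx; apply/eqP; apply: contraLR lt_ke => rx.
by rewrite -leqNgt -(expg_mul_eq0 k rx).
Qed.

Definition pow_ideal k : {set R} := [set g ^+ k * x | x : R].


(** Every element of the [k]-th ideal is uniquely [g ^+ k * s c + z] with [c] in [F] and [z] in the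
    next ideal. The map [s] need not be additive: uniqueness of [c] is read off through [res]. *)
Lemma card_pow_idealS k :
  (k < e)%N -> #|pow_ideal k| = (#|F| * #|pow_ideal k.+1|)%N.
Proof.
move=> lt_ke; pose f (p : F * R) := g ^+ k * s p.1 + p.2.
have -> : pow_ideal k = f @: setX [set: F] (pow_ideal k.+1).
  apply/setP => z; apply/imsetP/imsetP => [[x _ ->]|[[c z']]].
    have /res_ker[y xy] : res (x - s (res x)) = 0 by rewrite rmorphB sK subrr.
    exists (res x, g ^+ k.+1 * y); first by rewrite in_setX inE; apply: imset_f.
    by rewrite /f /= exprSr -mulrA -xy mulrBr addrC subrK.
  rewrite !inE /= => /imsetP[y _ ->] ->; exists (s c + g * y) => //.
  by rewrite /f /= exprSr mulrDr mulrA.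
rewrite card_in_imset ?cardsX ?cardsT //.
move=> [c _] [d _] /setXP[_ /imsetP[x _ ->]] /setXP[_ /imsetP[y _ ->]].
rewrite /f /= => eq_f.
have cd : c = d.
  apply/eqP; rewrite -subr_eq0; apply/eqP.
  have : res (s c - s d + g * (x - y)) = 0.
    apply: (res_expg_mul0 lt_ke); move/eqP: eq_f; rewrite -subr_eq0 => /eqP <-.
    by rewrite exprSr; ring.
  by rewrite rmorphD rmorphB !sK res_g addr0.
by move: eq_f; rewrite cd => /addrI ->.
Qed.

Lemma card_pow_ideal k : (k <= e)%N -> #|pow_ideal k| = (#|F| ^ (e - k))%N.
Proof.
move: {2}(e - k)%N (erefl (e - k)%N) => j.
elim: j k => [|j IHj] k ejk le_ke; rewrite ejk.
  have -> : k = e by lia.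
  rewrite expn0 -(cards1 (0 : R)); apply: eq_card => z; rewrite inE.
  apply/imsetP/eqP => [[x _ ->]|->]; first by rewrite ge0 mul0r.
  by exists 0; rewrite ?mulr0.
by rewrite card_pow_idealS ?(IHj k.+1) ?expnS; [congr (_ * _ ^ _)%N | | |]; lia.
Qed.

Lemma mem_pow_ideal k j u : (j <= e)%N -> res u != 0 ->
  (g ^+ k * u \in pow_ideal j) = (j <= k)%N.
Proof.
move=> le_je ru; apply/imsetP/idP => [[x _ gux]|le_jk]; last first.
  by exists (g ^+ (k - j) * u); rewrite // mulrA -exprD subnKC.
rewrite leqNgt; apply: contra ru => lt_kj.
have : g ^+ k * (u - g * (g ^+ (j - k.+1) * x)) = 0.
  by rewrite mulrBr gux -(subnK lt_kj) addnK addnS exprS exprD; ring.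
move/(res_expg_mul0 (leq_trans lt_kj le_je)).
by rewrite rmorphB res_g subr0 => ->.
Qed.

(* The [g]-adic valuation, with value [e] at [0]. *)
Definition valuation x : nat := \sum_(k < e) (x \in pow_ideal k.+1).

Lemma leq_valuation x : (valuation x <= e)%N.
Proof.
by rewrite -[leqRHS]muln1 -[e in leqRHS]card_ord -sum_nat_const leq_sum // => i _; case: in_mem.
Qed.

Lemma valuation_expg_mul k u : (k <= e)%N -> res u != 0 -> valuation (g ^+ k * u) = k.
Proof.
move=> le_ke ru; rewrite /valuation.
transitivity (\sum_(0 <= i < e) (i < k))%N.
  by rewrite big_mkord; apply: eq_bigr => i _; rewrite mem_pow_ideal.
rewrite (big_cat_nat (n := k)) //= (big_nat_cond _ _ 0) (eq_bigr (fun=> 1%N)).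
  rewrite -big_nat_cond sum_nat_const_nat muln1 subn0 big_nat big1 ?addn0 // => i.
  by case/andP=> le_ki _; rewrite ltnNge le_ki.
by move=> i /andP[/andP[_ ->]].
Qed.

Lemma valuation_decomp x : exists2 u, res u != 0 & x = g ^+ valuation x * u.
Proof.
(* Factors [g] are moved out of [y] until its residue is nonzero. At exponent [e] the product is 0
   and the unit 1 serves. *)
have decomp j : forall k y, (k <= e)%N -> (e - k)%N = j ->
    exists2 i, (i <= e)%N & exists2 u, res u != 0 & g ^+ k * y = g ^+ i * u.
  elim: j => [|j IHj] k y le_ke ejk.
    exists e => //; exists 1; first by rewrite rmorph1 oner_eq0.
    by have -> : k = e; [lia | rewrite ge0 !mul0r].
  have [/eqP/res_ker[z ->]|ry] := boolP (res y == 0); last first.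
    by exists k => //; exists y.
  by rewrite mulrA -exprSr; apply: IHj; lia.
have [k le_ke [u ru]] := decomp _ 0%N x (leq0n e) erefl.
by rewrite mul1r => ->; exists u; rewrite ?valuation_expg_mul.
Qed.

Lemma card_valuation k : (k < e)%N ->
  #|[set x | valuation x == k]| = ((#|F| - 1) * #|F| ^ (e - 1 - k))%N.
Proof.
move=> lt_ke.
have -> : [set x | valuation x == k] = pow_ideal k :\: pow_ideal k.+1.
  apply/setP => x; rewrite !inE; have [u ru def_x] := valuation_decomp x.
  by rewrite [in RHS]def_x !mem_pow_ideal //; lia.
rewrite cardsD (setIidPr _); last first.
  by apply/subsetP => _ /imsetP[x _ ->]; rewrite exprSr -mulrA imset_f.
rewrite !card_pow_ideal //; last exact: ltnW.
rewrite mulnBl mul1n -expnS; congr (_ ^ _ - _ ^ _)%N; lia.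
Qed.

Lemma prod_eq0_valuation (I : finType) (b : I -> R) :
  (\prod_i b i == 0) = (e <= \sum_i valuation (b i))%N.
Proof.
have /fin_all_exists2[u ru def_b] i := valuation_decomp (b i).
rewrite (eq_bigr _ (fun i _ => def_b i)) big_split /= prodrXr.
by rewrite expg_mul_eq0 // rmorph_prod; apply/prodf_neq0 => i _.
Qed.

(* [a ^+ q - 1 = (a - 1) * \sum_(i < q) a ^+ i], where the sum has residue
   [q = 0], so each [q]-th power gains a factor [g]. *)
Lemma exp_card_congr1 k x :
  res x = 1 -> exists y, x ^+ (#|F| ^ k) = 1 + g ^+ k.+1 * y.
Proof.
move=> rx; elim: k => [|k [y IHk]].
  have /res_ker[y xy] : res (x - 1) = 0 by rewrite rmorphB rx rmorph1 subrr.
  by exists y; rewrite -xy addrC subrK.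
set a := x ^+ (#|F| ^ k) in IHk.
have /res_ker[t st] : res (\sum_(i < #|F|) a ^+ i) = 0.
  rewrite rmorph_sum (eq_bigr (fun=> 1)) => [|i _].
    by rewrite sumr_const card_ord natr_card_eq0.
  by rewrite !rmorphXn rx !expr1n.
exists (y * t); rewrite expnSr exprM -/a; apply/eqP.
rewrite addrC -subr_eq subrX1 st IHk addrC addKr (exprSr g k.+1).
by apply/eqP; ring.
Qed.

(** Raising to the power [#|F| ^ e] fixes residues, and sends [s z ^+ n], whose residue is 1, to 1
    modulo [g ^+ e.+1 = 0]. *)
Lemma lift_unity_root n z : z ^+ n = 1 -> exists2 w, w ^+ n = 1 & res w = z.
Proof.
move=> zn; exists (s z ^+ (#|F| ^ e)); last first.
  rewrite rmorphXn sK; elim: e => [|k IHk]; first by rewrite expr1.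
  by rewrite expnSr exprM IHk expf_card.
have [|y] := @exp_card_congr1 e (s z ^+ n); first by rewrite rmorphXn sK.
by rewrite exprAC => ->; rewrite exprS ge0 mulr0 mul0r addr0.
Qed.

End ChainRing.

(** * Counting tuples by generating polynomials *)

Lemma hockey_stick n i : (\sum_(k < i.+1) 'C(n + k, n) = 'C(n.+1 + i, n.+1))%N.
Proof.
elim: i => [|i IHi]; first by rewrite big_ord_recl big_ord0 !addn0 !binn.
by rewrite big_ord_recr /= IHi (addnS n.+1) binS addSnnS.
Qed.

(** Coefficients of a product below degree [e] only involve those of the factors below [e]. In the
    convolution the powers of [t] combine to [t ^- i], leaving a hockey-stick sum of binomials. *)
Lemma coef_exp_geometric (K : fieldType) (p : {poly K}) (c t : K) e n i :
  t != 0 -> (forall k, (k < e)%N -> p`_k = c * t ^- k) -> (i < e)%N ->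
  (p ^+ n.+1)`_i = c ^+ n.+1 * ('C(n + i, n)%:R * t ^- i).
Proof.
move=> t0 pE; elim: n i => [|n IHn] i lt_ie.
  by rewrite bin0 mul1r !expr1 pE.
rewrite exprSr coefM -hockey_stick natr_sum mulr_suml mulr_sumr.
apply: eq_bigr => k _; have le_ki : (k <= i)%N by rewrite -ltnS.
rewrite IHn ?pE; [|lia|lia].
have -> : t ^- i = t ^- k * t ^- (i - k) by rewrite -invfM -exprD subnKC.
rewrite [c ^+ n.+2]exprSr; ring.
Qed.

Lemma coef_sum_Xn (T : finType) (v : T -> nat) k :
  (\sum_x 'X^(v x) : {poly rat})`_k = #|[set x | v x == k]|%:R.
Proof.
rewrite coef_sum -sum1_card natr_sum big_mkcond [RHS]big_mkcond /=.
by apply: eq_bigr => x _; rewrite coefXn inE eq_sym; case: eqP.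
Qed.

Lemma card_sum_lt (T : finType) (v : T -> nat) (c t : rat) (e n : nat) :
  t != 0 -> (forall k, (k < e)%N -> #|[set x | v x == k]|%:R = c * t ^- k) ->
  #|[set f : {ffun 'I_n.+1 -> T} | (\sum_i v (f i) < e)%N]|%:R =
    c ^+ n.+1 * \sum_(i < e) 'C(n + i, n)%:R * t ^- i.
Proof.
move=> t0 card_v; pose p : {poly rat} := \sum_x 'X^(v x).
(* Expanding the power gives one monomial per tuple, whose exponent is the total of [v]. *)
have coef_pn i : (p ^+ n.+1)`_i =
    #|[set f : {ffun 'I_n.+1 -> T} | (\sum_j v (f j))%N == i]|%:R.
  rewrite -coef_sum_Xn -[in LHS](card_ord n.+1) -prodr_const bigA_distr_bigA.
  by under [in LHS]eq_bigr do rewrite prodrXr.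
transitivity (\sum_(i < e) (p ^+ n.+1)`_i).
  under eq_bigr do rewrite coef_pn.
  rewrite -natr_sum; congr _%:R.
  under [RHS]eq_bigr do rewrite -sum1dep_card.
  rewrite (exchange_big_dep (fun f : {ffun 'I_n.+1 -> T} => (\sum_j v (f j) < e)%N)) /=; last first.
    by move=> i f _ /eqP ->.
  rewrite -sum1dep_card; apply: eq_bigr => f lt_fe.
  by rewrite (big_pred1 (Ordinal lt_fe)) // => i; rewrite eq_sym.
rewrite mulr_sumr; apply: eq_bigr => i _.
by apply: (coef_exp_geometric (e := e)) => // k lt_ke; rewrite coef_sum_Xn card_v.
Qed.

(** * Diagonalisation of circulant matrices *)

Lemma cir_mul_Vandermonde (R : comNzRingType) (n : nat) (w : R) (a : 'rV[R]_n) :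
  w ^+ n = 1 ->
  let V : 'M_n := Vandermonde n (\row_j w ^+ j) in
  cir a *m V = V *m diag_mx (a *m V).
Proof.
move=> wn /=; apply/matrixP => i k; rewrite mul_mx_diag !mxE mulr_sumr.
have iter_bij (m : nat) : bijective (iter m (@ordS n)).
  exists (iter m (@ord_pred n)) => x; elim: m x => //= m IHm x.
    by rewrite -iterS iterSr ordSK.
  by rewrite -iterS iterSr ord_predK.
(* Undoing the shift of row [i] multiplies the entries of column [k] by [w ^+ (i * k)], so that
   column is an eigenvector; the wrap-around is harmless as [w ^+ n = 1]. *)
rewrite (reindex _ (onW_bij _ (iter_bij i))) /=.
apply: eq_bigr => m _; rewrite !mxE.
have -> : iter i (@ord_pred n) (iter i (@ordS n) m) = m.
  by elim: (nat_of_ord i) => //= j IHj; rewrite -iterS iterSr ordSK.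
rewrite mulrCA -exprD -!exprM ![(k * _)%N]mulnC ![w ^+ (_ * k)]exprM.
congr (_ * _ ^+ k); elim: (nat_of_ord i) => //= j IHj.
by rewrite expr_mod // exprS IHj -exprS.
Qed.

(* [R] carries no unit-ring structure: [d] witnesses that the determinant is
   invertible. *)
Lemma num_circulant_det0 (R : finComNzRingType) (n : nat) (w d : R) :
  (0 < n)%N -> w ^+ n = 1 ->
  \det (Vandermonde n (\row_j w ^+ j) : 'M_n) * d = 1 ->
  num_circulant_det n (0 : R) =
    #|[set b : {ffun 'I_n -> R} | \prod_i b i == 0]|.
Proof.
move=> n_gt0 wn; set V : 'M_n := Vandermonde n _ => Vd.
have cir_inj : injective (@cir R n).
  move=> a b /matrixP eq_ab; apply/rowP => j.
  by have := eq_ab (Ordinal n_gt0) j; rewrite !mxE.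
pose f (a : 'rV[R]_n) := [ffun i => (a *m V) 0 i].
have f_inj : injective f.
  move=> a b /ffunP eq_f; have eq_ab : a *m V = b *m V.
    by apply/rowP => i; have := eq_f i; rewrite !ffunE.
  have VK (c : 'rV_n) : d *: (c *m V *m \adj V) = c.
    by rewrite -mulmxA mul_mx_adj mul_mx_scalar scalerA mulrC Vd scale1r.
  by rewrite -(VK a) eq_ab VK.
have f_bij : bijective f.
  by apply: inj_card_bij => //; rewrite card_mx card_ffun card_ord mul1n.
have det_cir a : \det (cir a) = \prod_i f a i.
  have := congr1 (@determinant R n) (cir_mul_Vandermonde a wn).
  rewrite -/V !det_mulmx [RHS]mulrC => /(congr1 ( *%R^~ d)).
  rewrite -!mulrA Vd !mulr1 det_diag => ->.
  by apply: eq_bigr => i _; rewrite ffunE.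
rewrite -(on_card_preimset (onW_bij _ f_bij)) -(card_imset _ cir_inj).
apply: eq_card => A; rewrite inE; apply/andP/imsetP => [[/existsP[a /eqP->]]|[a]].
  by move=> det0; exists a; rewrite // !inE -det_cir.
by rewrite !inE -det_cir => det0 ->; split=> //; apply/existsP; exists a.
Qed.

(** * Residue data of the chain ring and the final count *)

Theorem theorem4p8 (R : finComNzRingType) (M : idealr R) (gamma : R)
    (F : finFieldType) (phi : {rmorphism {ideal_quot M} -> F}) (e q n : nat)
    (hR : chain_ring R)
    (hM : maximal_ideal M) (hgamma : generates gamma M)
    (he : nilpotency_index gamma e)
    (hphi : bijective phi) (hq : #|F| = q)
    (hn : (0 < n)%N) (hdvd : (n %| q - 1)%N) :
  (num_circulant_det n (0 : R))%:R =
    q%:R ^+ (n * e)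
    - (q%:R - 1) ^+ n * q%:R ^+ ((e - 1) * n)
      * \sum_(0 <= i < e) 'C(n + i - 1, n - 1)%:R * q%:R ^- i :> rat.
Proof.
have [e_gt0 ge0 gmin] := he; have [psi phiK psiK] := hphi.
pose res : {rmorphism R -> F} := phi \o \pi_({ideal_quot M})%qT.
pose s (c : F) : R := repr (psi c).
have sK : cancel s res by move=> c; rewrite /res /= reprK psiK.
have res_ker x : res x = 0 <-> exists y, x = gamma * y.
  split=> [rx|/hgamma Mx].
    apply/hgamma; rewrite -[x]subr0 Quotient.idealrBE; apply/eqP.
    by apply: (can_inj phiK); rewrite [LHS]rx !rmorph0.
  rewrite -(rmorph0 res); congr (phi _); apply/eqP.
  by rewrite -Quotient.idealrBE subr0.
have gN0 k : (k < e)%N -> gamma ^+ k != 0.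
  (* Minimality of [e] concerns positive exponents only, so exponent 0 is treated apart. *)
  case: k => [|k] lt_ke; first by rewrite oner_eq0.
  by apply: contraTneq lt_ke => /gmin; rewrite -leqNgt => ->.
have q_gt1 : (1 < q)%N by rewrite -hq finNzRing_gt1.
have [|z prim_z] := @ex_prim_root F n hn; first by rewrite hq -subn1.
have [w wn rw] := lift_unity_root sK res_ker ge0 (prim_expr_order prim_z).
have [d Vd] : exists d, \det (Vandermonde n (\row_j w ^+ j) : 'M_n) * d = 1.
  (* The residue of the determinant is a product of differences of distinct powers of [z], since
     [0 < j - i < n]. *)
  apply: (res_neq0_inv sK res_ker ge0); rewrite det_Vandermonde rmorph_prod.
  apply/prodf_neq0 => i _; rewrite rmorph_prod; apply/prodf_neq0 => j lt_ij.
  rewrite !mxE rmorphB !rmorphXn rw subr_eq0 (eq_prim_root_expr prim_z).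
  rewrite eqn_mod_dvd ?(ltnW lt_ij) // gtnNdvd ?subn_gt0 //.
  exact: leq_ltn_trans (leq_subr _ _) (ltn_ord j).
rewrite (num_circulant_det0 hn wn Vd).
have card_R : #|R| = (q ^ e)%N.
  have := card_pow_ideal sK res_ker ge0 gN0 (leq0n e).
  rewrite hq subn0 => <-; apply: eq_card => x; rewrite !inE; apply/esym/imsetP.
  by exists x; rewrite ?mul1r.
have q0 : q%:R != 0 :> rat by rewrite pnatr_eq0; lia.
case: n hn {hdvd prim_z wn Vd} => // n _.
pose S := [set b : {ffun 'I_n.+1 -> R} | (\sum_i valuation gamma e (b i) < e)%N].
have -> : [set b : {ffun 'I_n.+1 -> R} | \prod_i b i == 0] = ~: S.
  apply/setP => b; rewrite !inE -leqNgt.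
  exact: (prod_eq0_valuation sK res_ker ge0 gN0).
(* The class sizes [(q - 1) * q ^ (e - 1 - k)] form a geometric sequence in [k] with ratio
   [q^-1]. *)
have card_S := @card_sum_lt _ (valuation gamma e) ((q%:R - 1) * q%:R ^+ (e - 1)) q%:R e n q0.
rewrite cardsCs setCK natrB ?max_card // card_ffun card_ord card_R -expnM.
rewrite natrX mulnC card_S => [|k lt_ke]; last first.
  rewrite (card_valuation sK res_ker ge0 gN0 lt_ke) hq natrM natrB ?natrX; last lia.
  rewrite -mulrA; congr (_ * _); rewrite expfB_cond ?(negPf q0) //; lia.
rewrite exprMn -exprM big_mkord; congr (_ - _ * _).
by apply: eq_bigr => i _; rewrite addSn !subn1.
Qed.
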